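(* Let $M$ be an $m$-dimensional Riemannian manifold with Riemannian measure $\mu$, let $\Omega\subset M$ be an open, relatively compact, connected subset, and for $\delta>0$ let $\mathcal S^\delta=\{x\in\Omega:\operatorname{dist}(x,\partial\Omega)<\delta\}$. Let $V\in C(\Omega)$, $V>0$ in $\Omega$. Suppose that there exists $C>0$ such that for any $\alpha>0$ there exists $\phi_\alpha\in W^{1,2}_0(\Omega)\cap L^2_V(\Omega)$, with $\phi_\alpha\not\equiv0$, for which $$\int_\Omega|\nabla\phi_\alpha|^2\,d\mu\le C\alpha\int_\Omega V\phi_\alpha^2\,d\mu$$ and $$\int_{\mathcal S^{2\delta}\setminus\mathcal S^{\delta}}|\phi_\alpha|^2\,d\mu=o(\delta^2)\quad\text{as }\delta\to0^+.$$ Then $\bar\lambda(\Omega)=0$.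
   Context: $L^2_V(\Omega)=\{f:\Omega\to\mathbb R\text{ measurable such that }\int_\Omega f^2V\,d\mu<\infty\}$. For $\delta>0$ let $\Omega^\delta=\Omega\setminus\overline{\mathcal S^\delta}$. Let $\lambda_\delta$ be the first eigenvalue of the weighted Dirichlet problem $\Delta\phi+\lambda V\phi=0$ in $\Omega^\delta$, $\phi=0$ on $\partial\Omega^\delta$, where $\Delta$ is the Laplace-Beltrami operator, i.e. $$\lambda_\delta=\inf_{\phi\in C_c^\infty(\Omega^\delta),\,\phi\not\equiv0}\frac{\int_{\Omega^\delta}|\nabla\phi|^2\,d\mu}{\int_{\Omega^\delta}V\phi^2\,d\mu}.$$ Then $\lambda_\delta$ is monotone in $\delta$ and $\bar\lambda(\Omega):=\lim_{\delta\to0^+}\lambda_\delta\in[0,\infty)$; equivalently, $$\bar\lambda(\Omega)=\inf_{\phi\in C_c^\infty(\Omega),\,\phi\not\equiv0}\frac{\int_\Omega|\nabla\phi|^2\,d\mu}{\int_\Omega V\phi^2\,d\mu}.$$ *)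

(* Defs.v *)
From HB Require Import structures.
From mathcomp Require Import all_boot all_order all_algebra.
From mathcomp Require Import all_classical all_reals all_analysis.

Set Implicit Arguments.
Unset Strict Implicit.
Unset Printing Implicit Defensive.

Import Order.TTheory GRing.Theory Num.Theory.
Import numFieldNormedType.Exports.

Local Open Scope classical_set_scope.
Local Open Scope ring_scope.

Section Euclidean.
Context (R : realType).

Definition partial_deriv (m : nat) (a : 'I_m) (f : 'rV[R]_m -> R)
  : 'rV[R]_m -> R := fun y => 'D_(delta_mx ord0 a) f y.

Fixpoint iter_partial_deriv (m : nat) (s : seq 'I_m) (f : 'rV[R]_m -> R)
  : 'rV[R]_m -> R :=
  if s is a :: s' then partial_deriv a (iter_partial_deriv s' f) else f.

(* C^infinity on the open set U: partial derivatives of all orders exist and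
   are continuous.  Values of f outside U are irrelevant. *)
Definition smooth_on (m : nat) (U : set 'rV[R]_m) (f : 'rV[R]_m -> R) : Prop :=
  forall (s : seq 'I_m) (y : 'rV[R]_m), U y ->
    (forall a : 'I_m, derivable (iter_partial_deriv s f) y (delta_mx ord0 a)) /\
    {for y, continuous (iter_partial_deriv s f)}.

(* The Lebesgue integral over R^n of a nonnegative Borel function, as an
   iterated one-dimensional integral (Tonelli). *)
Fixpoint integral_rV (n : nat) : ('rV[R]_n -> \bar R) -> \bar R :=
  match n with
  | 0 => fun f => f 0
  | n'.+1 => fun f =>
      (\int[@lebesgue_measure R]_t
         integral_rV (fun y : 'rV[R]_n' =>
           f (row_mx (t : R)%:M y : 'rV[R]_(1 + n'))))%E
  end.

End Euclidean.

(* A smooth m-manifold structure (without boundary) on the space M, given by a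
   smooth atlas.  The values of [chart_map i] outside [chart_dom i] and of
   [chart_inv i] outside the image of the chart are irrelevant.  [chart_at]
   selects a chart around each point: this expresses that the charts cover M,
   and provides a chart in which coordinate-free pointwise quantities are
   computed. *)
Record smooth_manifold (R : realType) (m : nat) (M : ptopologicalType) := {
  chart_idx : Type;
  chart_dom : chart_idx -> set M;
  chart_map : chart_idx -> M -> 'rV[R]_m;
  chart_inv : chart_idx -> 'rV[R]_m -> M;
  chart_at : M -> chart_idx;
  manifold_hausdorff : hausdorff_space M;
  manifold_second_countable : @second_countable M;
  chart_dom_open : forall i, open (chart_dom i);
  chart_cod_open : forall i, open (chart_map i @` chart_dom i);
  chart_mapK : forall i x, chart_dom i x -> chart_inv i (chart_map i x) = x;
  chart_map_cont :
    forall i x, chart_dom i x -> {for x, continuous (chart_map i)};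
  chart_inv_cont : forall i x, chart_dom i x ->
    {for chart_map i x, continuous (chart_inv i)};
  chart_at_dom : forall x, chart_dom (chart_at x) x;
  chart_transition_smooth : forall i j (b : 'I_m),
    smooth_on (chart_map i @` (chart_dom i `&` chart_dom j))
      (fun y => chart_map j (chart_inv i y) ord0 b)
}.

(* The measurable space of Borel sets of M. *)
Definition borel (M : ptopologicalType) := g_sigma_algebraType (@open M).

Section Tensors.
Context (R : realType) (m : nat) (M : ptopologicalType).
Variable (S : smooth_manifold R m M).
Local Notation idx := (chart_idx S).

Definition chart_cod (i : idx) : set 'rV[R]_m := chart_map i @` chart_dom i.

(* entry (a, b) is d y_j^b / d y_i^a at x, for charts i and j around x *)
Definition transition_jac (i j : idx) (x : M) : 'M[R]_m :=
  \matrix_(a, b)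
    partial_deriv a (fun y => chart_map j (chart_inv i y) ord0 b) (chart_map i x).

(* [metric_coef i x] is the Gram matrix (g_ab) at x in the coordinates of the
   chart i. *)
Record riemannian_metric := {
  metric_coef : idx -> M -> 'M[R]_m;
  metric_smooth : forall i (a b : 'I_m),
    smooth_on (chart_cod i) (fun y => metric_coef i (chart_inv i y) a b);
  metric_sym : forall i x, chart_dom i x -> (metric_coef i x)^T = metric_coef i x;
  metric_posdef : forall i x (v : 'rV[R]_m), chart_dom i x -> v != 0 ->
    0 < (v *m metric_coef i x *m v^T) ord0 ord0;
  metric_transition : forall i j x, chart_dom i x -> chart_dom j x ->
    metric_coef i x =
      transition_jac i j x *m metric_coef j x *m (transition_jac i j x)^T
}.

(* A vector field is given by its components in every chart, [X i x] being the
   row of components at x in the chart i; [vector_field_on] is the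
   transformation law over A. *)
Definition field := idx -> M -> 'rV[R]_m.

Definition vector_field_on (A : set M) (X : field) : Prop :=
  forall i j x, A x -> chart_dom i x -> chart_dom j x ->
    X j x = X i x *m transition_jac i j x.

Definition measurable_field_on (A : set M) (X : field) : Prop :=
  forall i (a : 'I_m),
    measurable_fun (A `&` chart_dom i : set (borel M)) (fun x => X i x ord0 a).

Definition smooth_function (f : M -> R) : Prop :=
  forall i, smooth_on (chart_cod i) (f \o chart_inv i).

(* C_c^infinity(U), for U open; functions are extended by 0 to M *)
Definition Cc_smooth (U : set M) (f : M -> R) : Prop :=
  [/\ smooth_function f,
      compact (closure [set x | f x != 0]) &
      closure [set x | f x != 0] `<=` U].

Definition Cc_smooth_field (U : set M) (Y : field) : Prop :=
  [/\ vector_field_on setT Y,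
      forall i (a : 'I_m),
        smooth_on (chart_cod i) (fun y => Y i (chart_inv i y) ord0 a),
      compact (closure [set x | Y (chart_at S x) x != 0]) &
      closure [set x | Y (chart_at S x) x != 0] `<=` U].

End Tensors.

Section Riemannian.
Context (R : realType) (m : nat) (M : ptopologicalType).
Context (S : smooth_manifold R m M).
Variable (g : riemannian_metric S).
Local Notation idx := (chart_idx S).

Definition inner (x : M) (u v : 'rV[R]_m) : R :=
  (u *m metric_coef g (chart_at S x) x *m v^T) ord0 ord0.

Definition field_inner (X Y : field S) (x : M) : R :=
  inner x (X (chart_at S x) x) (Y (chart_at S x) x).

Definition field_normsq (X : field S) (x : M) : R := field_inner X X x.

(* (grad f)^a = g^{ab} d_b f *)
Definition gradient (f : M -> R) : field S := fun i x =>
  (\row_b partial_deriv b (f \o chart_inv i) (chart_map i x))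
    *m invmx (metric_coef g i x).

Definition vol_density (i : idx) (x : M) : R :=
  Num.sqrt (\det (metric_coef g i x)).

(* div Y = |g|^{-1/2} d_a (|g|^{1/2} Y^a) *)
Definition divergence (Y : field S) (x : M) : R :=
  let i := chart_at S x in
  (vol_density i x)^-1 *
  \sum_(a < m) partial_deriv a
    (fun y => vol_density i (chart_inv i y) * Y i (chart_inv i y) ord0 a)
    (chart_map i x).

(* dmu = |g|^{1/2} dy in every chart; on a second countable manifold there is
   exactly one such Borel measure *)
Definition riemannian_measure (mu : {measure set (borel M) -> \bar R}) : Prop :=
  forall (i : idx) (A : set (borel M)), measurable A -> A `<=` chart_dom i ->
    mu A = integral_rV (fun y : 'rV[R]_m =>
      (\1_(chart_map i @` A) y * vol_density i (chart_inv i y))%:E).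

(* gamma restricted to [0, 1] is C^1, up to and including the endpoints *)
Definition C1_curve (gamma : R -> M) : Prop :=
  forall t : R, 0 <= t <= 1 ->
    {for t, continuous gamma} /\
    forall i : idx, chart_dom i (gamma t) ->
      (\forall s \near t, derivable (chart_map i \o gamma) s 1) /\
      {for t, continuous (derive1 (chart_map i \o gamma))}.

Definition speed (gamma : R -> M) (t : R) : R :=
  let v : 'rV[R]_m := derive1 (chart_map (chart_at S (gamma t)) \o gamma) t in
  Num.sqrt (inner (gamma t) v v).

Definition curve_length (gamma : R -> M) : R :=
  Rintegral (@lebesgue_measure R) `[0, 1]%classic (speed gamma).

(* x and y are joined by a piecewise C^1 curve of length l *)
Inductive joined : M -> M -> R -> Prop :=
| joined_nil x : joined x x 0
| joined_cons gamma y l : C1_curve gamma -> joined (gamma 1) y l ->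
    joined (gamma 0) y (curve_length gamma + l).

(* +oo between points of different components *)
Definition dist (x y : M) : \bar R :=
  ereal_inf [set l%:E | l in joined x y].

(* +oo when A is empty *)
Definition dist_set (x : M) (A : set M) : \bar R :=
  ereal_inf [set dist x y | y in A].

Definition boundary (Omega : set M) : set M := closure Omega `\` interior Omega.

Definition collar (Omega : set M) (delta : R) : set M :=
  [set x | Omega x /\ (dist_set x (boundary Omega) < delta%:E)%E].

Definition inner_domain (Omega : set M) (delta : R) : set M :=
  Omega `\` closure (collar Omega delta).

Section Spaces.
Variable (mu : {measure set (borel M) -> \bar R}).

Definition L2_weighted (Omega : set M) (V f : M -> R) : Prop :=
  measurable_fun (Omega : set (borel M)) f /\
  (\int[mu]_(x in Omega) (f x ^+ 2 * V x)%:E < +oo)%E.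

Definition L2 (Omega : set M) (f : M -> R) : Prop :=
  L2_weighted Omega (fun=> 1) f.

Definition L2_field (Omega : set M) (X : field S) : Prop :=
  [/\ vector_field_on Omega X, measurable_field_on Omega X &
      (\int[mu]_(x in Omega) (field_normsq X x)%:E < +oo)%E].

Definition weak_gradient (Omega : set M) (f : M -> R) (X : field S) : Prop :=
  forall Y : field S, Cc_smooth_field Omega Y ->
    Rintegral mu Omega (field_inner X Y) =
      - Rintegral mu Omega (fun x => f x * divergence Y x).

(* f is in W^{1,2}(Omega) and X is its weak gradient, which is determined
   almost everywhere by f *)
Definition W12 (Omega : set M) (f : M -> R) (X : field S) : Prop :=
  [/\ L2 Omega f, L2_field Omega X & weak_gradient Omega f X].

(* f is in the closure of C_c^infinity(Omega) in W^{1,2}(Omega), and X is the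
   weak gradient of f *)
Definition W12_0 (Omega : set M) (f : M -> R) (X : field S) : Prop :=
  W12 Omega f X /\
  forall e : R, 0 < e -> exists2 psi : M -> R, Cc_smooth S Omega psi &
    (\int[mu]_(x in Omega) ((f x - psi x) ^+ 2)%:E +
     \int[mu]_(x in Omega)
       (field_normsq (fun i z => X i z - gradient psi i z) x)%:E < e%:E)%E.

(* Both integrals are finite, and the second one is positive, when V is
   continuous and positive on U and phi in C_c^infinity(U) is not 0. *)
Definition rayleigh (U : set M) (V phi : M -> R) : R :=
  Rintegral mu U (field_normsq (gradient phi)) /
  Rintegral mu U (fun x => V x * phi x ^+ 2).

(* first eigenvalue of the weighted Dirichlet problem in U; +oo when U is
   empty *)
Definition first_eigenvalue (U : set M) (V : M -> R) : \bar R :=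
  ereal_inf [set (rayleigh U V phi)%:E | phi in
    [set phi | Cc_smooth S U phi /\ exists x, phi x != 0]].

End Spaces.
End Riemannian.

(* Main.v *)
Require Import Defs.
From HB Require Import structures.
From mathcomp Require Import all_boot all_order all_algebra.
From mathcomp Require Import all_classical all_reals all_analysis.
From mathcomp Require Import measurable_realfun ring lra.

Set Implicit Arguments.
Unset Strict Implicit.
Unset Printing Implicit Defensive.

Import Order.TTheory GRing.Theory Num.Theory.
Import numFieldNormedType.Exports.

Local Open Scope classical_set_scope.
Local Open Scope ring_scope.

(** The space W^{1,2}_0(Omega) is by definition the closure of the test
    functions of Omega, so each phi_alpha can be replaced by a test function psi
    close to it in W^{1,2}.  The Dirichlet energy of psi is then at most a
    constant times alpha I, where I is the integral of V phi_alpha^2.  The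
    weighted norm of psi is bounded below: I is finite, hence at least half of
    it lies over a set {V <= n}, where V is bounded and the L^2 distance of psi
    to phi_alpha controls the weighted one.  Hence the Rayleigh quotient of psi
    is at most a constant times alpha ([test_function]), which is as small as
    desired.

    It remains to see that psi is also a test function of the inner domain
    Omega^delta for small delta ([Cc_smooth_inner_domain]).  Its support is a
    compact subset of Omega, so that this amounts to saying that every point of
    Omega has a neighborhood at positive Riemannian distance from the complement
    of Omega ([dist_complement_gt0]).  For this a bump function h supported in
    a chart is built, whose derivative along any C^1 curve is at most K times
    the speed of the curve ([bump_function]).  Integrating along the curve shows
    that h is K-Lipschitz for the Riemannian distance, while h drops from a
    positive value to 0 when leaving Omega.  The comparison of velocities in
    different charts rests on the chain rule for functions with continuous
    partial derivatives ([is_derive_comp_partial]). *)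

(** * Integrals of nonnegative functions without measurability *)

Section LowerIntegral.
Context d (T : measurableType d) (R : realType).
Variable mu : {measure set T -> \bar R}.
Local Open Scope ereal_scope.
Import HBNNSimple.

(** The integral of a nonnegative function is a supremum over the simple
    functions below it, hence monotone even for non-measurable integrands. *)
Lemma le_lower_integral (D D' : set T) (f h : T -> \bar R) :
  (forall x, D x -> 0 <= f x) -> (forall x, D' x -> 0 <= h x) ->
  (forall x, (f \_ D) x <= (h \_ D') x) ->
  \int[mu]_(x in D) f x <= \int[mu]_(x in D') h x.
Proof.
move=> f0 h0 fh; rewrite !ge0_integralE//.
apply: ereal_sup_le => _ [s /= sf <-].
by exists s => // x; exact: le_trans (sf x) (fh x).
Qed.

(** Subadditivity holds as soon as one of the two terms is measurable: if s is
    simple and s <= k (f + g), then the positive part of s / k - g is measurable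
    and below f.  This is applied to gradients of test functions, whose norms
    then need not be shown measurable. *)
Lemma lower_integral_leD (D : set T) (f g h : T -> R) (k : R) :
  measurable D -> (0 < k)%R ->
  (forall x, D x -> (0 <= f x)%R) -> (forall x, D x -> (0 <= g x)%R) ->
  (forall x, D x -> (0 <= h x <= k * (f x + g x))%R) ->
  measurable_fun D g ->
  \int[mu]_(x in D) (h x)%:E <=
    k%:E * (\int[mu]_(x in D) (f x)%:E + \int[mu]_(x in D) (g x)%:E).
Proof.
move=> mD k0 f0 g0 hfg mg.
rewrite [leLHS]ge0_integralE; last first.
  by move=> x /hfg/andP[]; rewrite lee_fin.
apply: ge_ereal_sup => _ [s /= sh <-].
have s0 x : ~ D x -> s x = 0%R.
  move=> nDx; apply/eqP; rewrite eq_le fun_ge0 andbT -lee_fin.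
  by rewrite (le_trans (sh x))// patchE memNset.
have sD x : D x -> (s x <= h x)%R.
  by move=> Dx; have := sh x; rewrite patchE mem_set.
pose r x : R := Num.max (k^-1 * s x - g x)%R 0%R.
have mr : measurable_fun D r.
  apply: measurable_maxr => //; apply: measurable_funB => //.
  by apply: measurable_funM => //; exact: measurable_funTS.
have r0 x : (0 <= r x)%R by rewrite /r le_max lexx orbT.
have rf x : D x -> (r x <= f x)%R.
  move=> Dx; rewrite /r ge_max f0 // andbT lerBlDr ler_pdivrMl //.
  by apply: le_trans (sD _ Dx) _; case/andP: (hfg _ Dx).
have sr x : D x -> (s x <= k * (r x + g x))%R.
  by move=> Dx; rewrite -ler_pdivrMl// -lerBlDr /r le_max lexx.
rewrite -integralT_nnsfun.
have -> : \int[mu]_x (s x)%:E = \int[mu]_(x in D) (s x)%:E.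
  rewrite [RHS]integral_mkcond; apply: eq_integral => x _.
  rewrite patchE; case: ifPn => // /negP; rewrite inE => /s0 -> //.
apply: (@le_trans _ _ (\int[mu]_(x in D) (k * (r x + g x))%:E)).
  apply: ge0_le_integral => //.
  - by move=> x _; rewrite lee_fin.
  - exact/measurable_EFinP/measurable_funTS.
  - apply/measurable_EFinP; apply: measurable_funM => //.
    exact: measurable_funD.
under eq_integral do rewrite EFinM.
rewrite ge0_integralZl//=; last 3 first.
- by apply/measurable_EFinP; exact: measurable_funD.
- by move=> x Dx; rewrite lee_fin addr_ge0// g0.
- by rewrite lee_fin ltW.
under eq_integral do rewrite EFinD.
rewrite ge0_integralD//=; last 3 first.
- by move=> x _; rewrite lee_fin.
- exact/measurable_EFinP.
- exact/measurable_EFinP.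
rewrite lee_pmul2l// ?lte_fin// leeD2r//.
apply: le_lower_integral => //.
  by move=> x _; rewrite lee_fin.
move=> x; rewrite !patchE; case: ifPn => //; rewrite inE => Dx.
by rewrite lee_fin rf.
Qed.

End LowerIntegral.

(** * Borel measurability on a second countable space *)

(** A second countable space is covered by countably many basic open sets on
    which f is measurable.  This passes from measurability in each chart to
    measurability on the manifold. *)
Lemma measurable_fun_local (M : ptopologicalType) d (T : measurableType d)
    (D : set M) (f : M -> T) :
  @second_countable M -> open D ->
  (forall x, D x -> exists2 U : set M, open U /\ U x &
     measurable_fun (D `&` U : set (borel M)) f) ->
  measurable_fun (D : set (borel M)) f.
Proof.
move=> [B cB [Bo Bb]] Do loc _ Y mY.
have mopen (U : set M) : open U -> measurable (U : set (borel M)).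
  by move=> oU; exact: sub_sigma_algebra.
pose B' : set (set M) := [set b | B b /\
  measurable_fun (D `&` b : set (borel M)) f].
have -> : D `&` f @^-1` Y = \bigcup_(b in B') ((D `&` b) `&` f @^-1` Y).
  apply/seteqP; split=> [x [Dx Yx]|x [b _ [[Dx bx] Yx]]]; last by [].
  have [U [Uo Ux] mU] := loc _ Dx.
  have [b [Bb' bx] bU] := Bb x U (open_nbhs_nbhs (conj Uo Ux)).
  exists b => //; split=> //; apply: measurable_funS mU.
    by apply: mopen; exact: openI.
  exact: setIS.
have : countable B' by apply: sub_countable cB; apply: subset_card_le => b [].
case/pfcard_geP => [->|[e]]; first by rewrite bigcup_set0.
rewrite -(@image_eq _ _ _ _ e) bigcup_image.
apply: bigcupT_measurable => n.
have [Bn mn] : B' (e n) by exact: funS.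
by apply: mn => //; apply: mopen; apply: openI => //; exact: Bo.
Qed.

(** * Quadratic forms and the metric in charts *)

Definition qform (R : realType) (m : nat) (G : 'M[R]_m) (v : 'rV[R]_m) : R :=
  (v *m G *m v^T) ord0 ord0.

Lemma qformE (R : realType) (m : nat) (G : 'M[R]_m) (v : 'rV[R]_m) :
  qform G v = \sum_b (\sum_a v ord0 a * G a b) * v ord0 b.
Proof. by rewrite /qform mxE; apply: eq_bigr => b _; rewrite !mxE. Qed.

Lemma qform_parallelogram (R : realType) (m : nat) (G : 'M[R]_m)
    (u v : 'rV[R]_m) :
  qform G (u - v) + qform G (u + v) = 2 * (qform G u + qform G v).
Proof.
rewrite /qform [in (u + v)^T]linearD /= linearB /=.
rewrite !(mulmxDl, mulmxDr, mulmxN, mulNmx) opprK.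
move: (u *m _ *m u^T) (u *m _ *m v^T) (v *m _ *m u^T) (v *m _ *m v^T).
by move=> a b c d; rewrite !mxE; ring.
Qed.

Lemma qformZ (R : realType) (m : nat) (G : 'M[R]_m) k (v : 'rV[R]_m) :
  qform G (k *: v) = k ^+ 2 * qform G v.
Proof.
by rewrite /qform linearZ /= -!scalemxAl -scalemxAr !mxE mulrA expr2.
Qed.

Lemma continuous_sum_at (R : realType) (T : topologicalType) (I : finType)
    (F : I -> T -> R) x :
  (forall i, {for x, continuous (F i)}) ->
  {for x, continuous (fun z => \sum_i F i z)}.
Proof.
move=> cF; rewrite /continuous_at.
apply: cvg_big => [z|i _]; last exact: cF.
by apply: cvgD; [exact: cvg_fst|exact: cvg_snd].
Qed.

Lemma qform_continuous (R : realType) (m : nat) (T : topologicalType)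
    (G : T -> 'M[R]_m) (v : T -> 'rV[R]_m) x :
  (forall a b, {for x, continuous (fun z => G z a b)}) ->
  (forall a, {for x, continuous (fun z => v z ord0 a)}) ->
  {for x, continuous (fun z => qform (G z) (v z))}.
Proof.
move=> cG cv.
have -> : (fun z => qform (G z) (v z)) =
    (fun z => \sum_b (\sum_a v z ord0 a * G z a b) * v z ord0 b).
  by apply/funext => z; rewrite qformE.
apply: (@continuous_sum_at R _ _
  (fun b z => (\sum_a v z ord0 a * G z a b) * v z ord0 b)) => b.
apply: (@cvgM _ _ _ _ (fun z => \sum_a v z ord0 a * G z a b)); last exact: cv.
apply: (@continuous_sum_at R _ _ (fun a z => v z ord0 a * G z a b)) => a.
by apply: (@cvgM _ _ _ _ (fun z => v z ord0 a)); [exact: cv|exact: cG].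
Qed.

Lemma open_continuous_measurable (R : realType) (M : ptopologicalType)
    (D : set M) (f : M -> R) :
  open D -> (forall x, D x -> {for x, continuous f}) ->
  measurable_fun (D : set (borel M)) f.
Proof.
move=> oD cf.
apply: (measurability (RGenOpens.G (R:=R))).
  exact: RGenOpens.measurableE.
move=> _ [U [a [b ->]] <-]; apply: sub_sigma_algebra => /=.
have oU : open `]a, b[%classic by exact: interval_open.
rewrite openE => x [Dx Ux]; apply: filterI; first exact: open_nbhs_nbhs.
by apply: cf => //; exact: open_nbhs_nbhs.
Qed.

Section Charts.
Context (R : realType) (m : nat) (M : ptopologicalType).
Context (S : smooth_manifold R m M) (g : riemannian_metric S).

Lemma chart_continuous (T : topologicalType) (f : M -> T) i x :
  chart_dom i x ->
  {for chart_map i x, continuous (f \o chart_inv (s:=S) i)} ->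
  {for x, continuous f}.
Proof.
move=> ix cf.
have /= cfx : f (chart_inv i (chart_map i z)) @[z --> x] --> f x.
  rewrite -[in f x](chart_mapK ix).
  apply: (continuous_comp (f := chart_map i) (g := f \o chart_inv i)) => //.
  exact: chart_map_cont.
apply: cvg_trans cfx; apply: near_eq_cvg.
near=> z; rewrite chart_mapK//; near: z.
by apply: open_nbhs_nbhs; split => //; exact: chart_dom_open.
Unshelve. all: by end_near. Qed.

Lemma metric_coef_continuous i x a b :
  chart_dom i x -> {for x, continuous (fun z => metric_coef g i z a b)}.
Proof.
move=> ix; apply: (chart_continuous ix).
by have [] := metric_smooth g a b [::] (imageP _ ix).
Qed.

Lemma smooth_function_continuous (f : M -> R) :
  smooth_function S f -> continuous f.
Proof.
move=> sf x; have ix := chart_at_dom S x.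
apply: (chart_continuous ix).
by have [] := sf (chart_at S x) [::] _ (imageP _ ix).
Qed.

Lemma qform_metric_ge0 i x v :
  chart_dom i x -> 0 <= qform (metric_coef g i x) v.
Proof.
move=> ix; have [->|v0] := eqVneq v 0.
  by rewrite /qform !mul0mx mxE.
exact/ltW/metric_posdef.
Qed.

Lemma field_normsqE (X : field S) x :
  field_normsq g X x =
    qform (metric_coef g (chart_at S x) x) (X (chart_at S x) x).
Proof. by []. Qed.

Lemma field_normsq_ge0 (X : field S) x : 0 <= field_normsq g X x.
Proof. exact/qform_metric_ge0/chart_at_dom. Qed.

(** The transformation laws of vectors and of the metric cancel, so that squared
    norms can be computed in any chart; the default chart of a point depends on
    it in an uncontrolled way. *)
Lemma qform_transition i j x (v : 'rV[R]_m) : chart_dom i x -> chart_dom j x ->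
  qform (metric_coef g j x) (v *m transition_jac i j x) =
  qform (metric_coef g i x) v.
Proof.
by move=> ix jx; rewrite (metric_transition g ix jx) /qform trmx_mul !mulmxA.
Qed.

Lemma field_normsq_chart (A : set M) (X : field S) i x :
  vector_field_on A X -> A x -> chart_dom i x ->
  field_normsq g X x = qform (metric_coef g i x) (X i x).
Proof.
move=> vX Ax ix; have jx := chart_at_dom S x.
by rewrite field_normsqE (vX i) // qform_transition.
Qed.

Lemma field_normsq_measurable (A : set M) (X : field S) : open A ->
  vector_field_on A X -> measurable_field_on A X ->
  measurable_fun (A : set (borel M)) (field_normsq g X).
Proof.
move=> oA vX mX.
apply: (measurable_fun_local (manifold_second_countable S)) => // x Ax.
set i := chart_at S x.
exists (chart_dom i).
  by split; [exact: chart_dom_open|exact: chart_at_dom].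
apply: (eq_measurable_fun
  (fun z : borel M => qform (metric_coef g i z) (X i z))).
  by move=> z; rewrite inE => -[Az iz]; rewrite (field_normsq_chart vX Az iz).
under eq_fun do rewrite qformE.
have mg a b : measurable_fun (A `&` chart_dom i : set (borel M))
    (fun z => metric_coef g i z a b).
  apply: open_continuous_measurable; first exact/openI/chart_dom_open.
  by move=> z [_ iz]; exact: metric_coef_continuous.
apply: measurable_sum => b; apply: measurable_funM; last exact: mX.
by apply: measurable_sum => a; apply: measurable_funM => //; exact: mX.
Qed.

(** Y = X - (X - Y), and the parallelogram identity. *)
Lemma field_normsq_le_approx (X Y : field S) x :
  0 <= field_normsq g Y x <=
    2 * (field_normsq g (fun i z => X i z - Y i z) x + field_normsq g X x).
Proof.
rewrite field_normsq_ge0 /= !field_normsqE.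
set G := metric_coef _ _ _; set u := X _ _; set v := Y _ _.
have := qform_parallelogram G (u - v) u.
rewrite (_ : u - v - u = - v) 1?addrAC ?subrr ?sub0r// => <-.
have -> : qform G (- v) = qform G v.
  by rewrite /qform linearN /= mulmxN !mulNmx opprK.
by rewrite lerDl qform_metric_ge0//; exact: chart_at_dom.
Qed.

End Charts.

(** * Test functions with small Rayleigh quotient *)

Section RayleighQuotients.
Context (R : realType) (m : nat) (M : ptopologicalType).
Context (S : smooth_manifold R m M) (g : riemannian_metric S).
Context (mu : {measure set (borel M) -> \bar R}).

Lemma ge0_Rintegral (D : set M) (f : M -> R) :
  (forall x, D x -> 0 <= f x) -> 0 <= Rintegral mu D f.
Proof.
by move=> f0; apply: fine_ge0; apply: integral_ge0 => x Dx; rewrite lee_fin f0.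
Qed.

(** An infinite denominator becomes 0 as a real number, and then so does the
    quotient; the bound survives. *)
Lemma rayleigh_le (U : set M) (V psi : M -> R) (a b : R) :
  0 <= a -> 0 < b ->
  (\int[mu]_(x in U) (field_normsq g (gradient g psi) x)%:E <= a%:E)%E ->
  (b%:E <= \int[mu]_(x in U) (V x * psi x ^+ 2)%:E)%E ->
  rayleigh g mu U V psi <= a / b.
Proof.
move=> a0 b0 na bd; rewrite /rayleigh.
have n0 : Rintegral mu U (field_normsq g (gradient g psi)) <= a.
  rewrite -lee_fin fineK// ge0_fin_numE; first exact: le_lt_trans na (ltry _).
  by apply: integral_ge0 => x _; rewrite lee_fin field_normsq_ge0.
rewrite [X in _ / X]/Rintegral.
case: (\int[mu]_(x in U) _)%E bd => [d| |] //=.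
- rewrite lee_fin => bd; have d0 := lt_le_trans b0 bd.
  rewrite ler_pM ?invr_ge0 ?(ltW d0)//.
    by apply: ge0_Rintegral => x _; exact: field_normsq_ge0.
  by rewrite lef_pV2 // posrE.
- by move=> _; rewrite invr0 mulr0 divr_ge0// (ltW b0).
Qed.

Lemma rayleigh_ge0 (U : set M) (V psi : M -> R) :
  (forall x, U x -> 0 <= V x) -> 0 <= rayleigh g mu U V psi.
Proof.
move=> V0; rewrite divr_ge0//; apply: ge0_Rintegral => x Ux.
  exact: field_normsq_ge0.
by rewrite mulr_ge0 ?sqr_ge0 ?V0.
Qed.

Lemma measurable_sublevel (Omega : set M) (V : M -> R) (c : R) :
  measurable (Omega : set (borel M)) ->
  measurable_fun (Omega : set (borel M)) V ->
  measurable (Omega `&` [set x | V x <= c] : set (borel M)).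
Proof.
move=> mO mV.
rewrite (_ : _ `&` _ = Omega `&` V @^-1` `]-oo, c]%classic).
  exact: mV.
by apply/seteqP; split=> x [Ox] /=; rewrite in_itv.
Qed.

(** The sets {V <= n} exhaust Omega, because V takes real values: monotone
    convergence.  They play the role of an exhaustion by compact sets. *)
Lemma weighted_integral_trunc (Omega : set M) (V f : M -> R) (c : R) :
  measurable (Omega : set (borel M)) ->
  measurable_fun (Omega : set (borel M)) V ->
  measurable_fun (Omega : set (borel M)) f ->
  (forall x, Omega x -> 0 <= f x) ->
  (c%:E < \int[mu]_(x in Omega) (f x)%:E)%E ->
  exists n : nat,
    (c%:E < \int[mu]_(x in Omega `&` [set x | (V x <= n%:R)%R]) (f x)%:E)%E.
Proof.
move=> mO mV mf f0 cI; apply: contrapT => /forallNP nc.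
pose K n : set (borel M) := Omega `&` [set x | V x <= n%:R].
have mK n : measurable (K n) by exact: measurable_sublevel.
have OK : Omega = \bigcup_n K n.
  apply/seteqP; split=> [x Ox|x [n _ []]//].
  exists (Num.truncn (Num.max (V x) 0)).+1 => //; split=> //=.
  apply: le_trans (ltW (truncnS_gt _)).
  by rewrite le_max lexx.
have ndK : nondecreasing_seq K.
  move=> p n pn; apply/subsetPset => x [Ox] /= Vx; split=> //=.
  by rewrite (le_trans Vx)// ler_nat.
have mfK n : measurable_fun (K n) (EFin \o f).
  by apply/measurable_EFinP; apply: measurable_funS mf => // x [].
have fK n x : K n x -> (0 <= (EFin \o f) x)%E.
  by move=> [Ox _]; rewrite lee_fin f0.
have cvgK := ge0_nondecreasing_set_cvg_integral (mu := mu) ndK mK mfK fK.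
move: cI; rewrite OK; apply/negP; rewrite -leNgt -(cvg_lim _ cvgK)//.
apply: lime_le; first exact: cvgP cvgK.
by apply: nearW => n; rewrite leNgt; apply/negP/nc.
Qed.

Lemma weighted_norm_gt0 (Omega : set M) (V f : M -> R) :
  measurable (Omega : set (borel M)) ->
  measurable_fun (Omega : set (borel M)) V ->
  measurable_fun (Omega : set (borel M)) f ->
  (forall x, Omega x -> 0 < V x) ->
  ~ {ae mu, forall x, Omega x -> f x = 0} ->
  (0 < \int[mu]_(x in Omega) (V x * f x ^+ 2)%:E)%E.
Proof.
move=> mO mV mf V0 fN0; rewrite lt_def integral_ge0 ?andbT; last first.
  by move=> x Ox; rewrite lee_fin mulr_ge0 ?sqr_ge0// ltW ?V0.
apply/eqP => I0; apply: fN0.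
have mh : measurable_fun (Omega : set (borel M))
    (fun x => (V x * f x ^+ 2)%:E).
  apply/measurable_EFinP; apply: measurable_funM => //.
  exact: measurable_funX.
have /(ae_eq_integral_abs mu mO mh) h0 :
    (\int[mu]_(x in Omega) `|(V x * f x ^+ 2)%:E| = 0)%E.
  rewrite -I0; apply: eq_integral => x; rewrite inE => Ox.
  by rewrite gee0_abs// lee_fin mulr_ge0 ?sqr_ge0// ltW ?V0.
move: h0; apply: filterS => x h0 Ox.
have /eqP := h0 Ox; rewrite /cst eqe mulf_eq0 gt_eqF ?V0//= sqrf_eq0.
by move/eqP.
Qed.

(** The approximation of phi in W^{1,2} is chosen so close, at a distance e
    depending on a level n with more than half of the mass of V phi^2 over
    {V <= n}, that energy and weighted norm change by constant factors only.
    The bound holds for the quotient over any U between the support of psi and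
    Omega, hence for all inner domains that contain this support. *)
Lemma test_function (Omega : set M) (V phi : M -> R) (gradphi : field S)
    (k : R) :
  open Omega -> {within Omega, continuous V} ->
  (forall x, Omega x -> 0 < V x) -> 0 < k ->
  W12_0 g mu Omega phi gradphi -> L2_weighted mu Omega V phi ->
  ~ {ae mu, forall x, Omega x -> phi x = 0} ->
  (\int[mu]_(x in Omega) (field_normsq g gradphi x)%:E <=
     k%:E * \int[mu]_(x in Omega) (V x * phi x ^+ 2)%:E)%E ->
  exists psi : M -> R, [/\ Cc_smooth S Omega psi, exists x, psi x != 0 &
    forall U, U `<=` Omega -> (forall x, psi x != 0 -> U x) ->
      rayleigh g mu U V psi <= 32 * k].
Proof.
move=> oO cV V0 k0 [[_ [vX mX _] _] appr] [mphi finphi] phiN0 energy.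
have mO : measurable (Omega : set (borel M)) by exact: sub_sigma_algebra.
have V0' x : Omega x -> 0 <= V x by move=> /V0/ltW.
have mV : measurable_fun (Omega : set (borel M)) V.
  apply: open_continuous_measurable => //.
  move: cV; rewrite continuous_open_subspace// => cV x Ox.
  by apply: cV; rewrite inE.
have Vsq_ge0 (h : M -> R) x : Omega x -> 0 <= V x * h x ^+ 2.
  by move=> Ox; rewrite mulr_ge0 ?sqr_ge0// V0'.
have mVphi : measurable_fun (Omega : set (borel M)) (fun x => V x * phi x ^+ 2).
  by apply: measurable_funM => //; exact: measurable_funX.
have I_gt0 := weighted_norm_gt0 mO mV mphi V0 phiN0.
have I_fin : (\int[mu]_(x in Omega) (V x * phi x ^+ 2)%:E < +oo)%E.
  by under eq_integral do rewrite mulrC.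
move: energy I_gt0.
have := @weighted_integral_trunc Omega V _ _ mO mV mVphi (Vsq_ge0 phi).
case: (\int[mu]_(x in Omega) (V x * phi x ^+ 2)%:E)%E I_fin => [I _|//|//].
move=> trunc energy; rewrite lte_fin => I0.
have [n In] : exists n : nat, ((I / 2)%:E < \int[mu]_(x in
    Omega `&` [set x | (V x <= n%:R)%R]) (V x * phi x ^+ 2)%:E)%E.
  by apply: trunc; rewrite lte_fin ltr_pdivrMr// ltr_pMr// ltr1n.
(* The first bound on e keeps the energy of psi below 4 k I, the second one
   keeps its weighted norm over K above I / 8; whence 32 = 4 * 8. *)
pose e := Num.min (k * I) (I / 8 / n.+1%:R).
have e0 : 0 < e by rewrite lt_min mulr_gt0//= !divr_gt0.
have [psi psiC psi_appr] := appr _ e0.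
have sq0 x : 0 <= (phi x - psi x) ^+ 2 by exact: sqr_ge0.
have L0 : (0 <= \int[mu]_(x in Omega) ((phi x - psi x) ^+ 2)%:E)%E.
  by apply: integral_ge0 => x _; rewrite lee_fin.
have G0 : (0 <= \int[mu]_(x in Omega)
    (field_normsq g (fun i z => gradphi i z - gradient g psi i z) x)%:E)%E.
  by apply: integral_ge0 => x _; rewrite lee_fin field_normsq_ge0.
have Le : (\int[mu]_(x in Omega) ((phi x - psi x) ^+ 2)%:E <= e%:E)%E.
  by apply: le_trans (ltW psi_appr); rewrite leeDl.
have Ge : (\int[mu]_(x in Omega) (field_normsq g
    (fun i z => gradphi i z - gradient g psi i z) x)%:E <= e%:E)%E.
  by apply: le_trans (ltW psi_appr); rewrite leeDr.
have [psi_smooth _ _] := psiC.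
have mpsi : measurable_fun (Omega : set (borel M)) psi.
  apply: open_continuous_measurable => // x _.
  exact: smooth_function_continuous.
pose K : set (borel M) := Omega `&` [set x | (V x <= n%:R)%R].
have mK : measurable K by exact: measurable_sublevel.
have KO : K `<=` Omega by move=> x [].
have numer : (\int[mu]_(x in Omega) (field_normsq g (gradient g psi) x)%:E <=
    (4 * (k * I))%:E)%E.
  apply: le_trans (@lower_integral_leD _ _ _ mu Omega
    (field_normsq g (fun i z => gradphi i z - gradient g psi i z))
    (field_normsq g gradphi) _ 2 mO _ _ _ _ _) _ => //.
  - by move=> x _; exact: field_normsq_ge0.
  - by move=> x _; exact: field_normsq_ge0.
  - by move=> x _; exact: field_normsq_le_approx.
  - exact: field_normsq_measurable.
  apply: (@le_trans _ _ (2%:E * ((k * I)%:E + (k * I)%:E))%E).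
    rewrite lee_pmul2l// leeD//.
    by apply: le_trans Ge _; rewrite lee_fin /e ge_min lexx.
  by rewrite -EFinD -EFinM lee_fin; lra.
have denom : ((I / 8)%:E <= \int[mu]_(x in K) (V x * psi x ^+ 2)%:E)%E.
  have phipsi : (\int[mu]_(x in K) (V x * phi x ^+ 2)%:E <=
      2%:E * (\int[mu]_(x in K) (V x * psi x ^+ 2)%:E +
              \int[mu]_(x in K) (V x * (phi x - psi x) ^+ 2)%:E))%E.
    apply: lower_integral_leD => //.
    - by move=> x /KO; exact: (Vsq_ge0 psi).
    - by move=> x /KO; exact: (Vsq_ge0 (fun z => phi z - psi z)).
    - move=> x /KO Ox; rewrite (Vsq_ge0 phi)//=.
      have := mulr_ge0 (V0' _ Ox) (sqr_ge0 (2 * psi x - phi x)).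
      by set v := V x; set p := phi x; set q := psi x; lra.
    - apply: measurable_funM; first exact: measurable_funS mV.
      apply: measurable_funX; apply: measurable_funB.
        exact: measurable_funS mphi.
      exact: measurable_funS mpsi.
  have small : (\int[mu]_(x in K) (V x * (phi x - psi x) ^+ 2)%:E <=
      (I / 8)%:E)%E.
    apply: (@le_trans _ _ (n.+1%:R%:E *
        \int[mu]_(x in Omega) ((phi x - psi x) ^+ 2)%:E)%E).
      rewrite -ge0_integralZl//; last 2 first.
      - apply/measurable_EFinP; apply: measurable_funX.
        exact: measurable_funB.
      - by move=> x _; rewrite lee_fin.
      apply: le_lower_integral => [x /KO|x _|x].
      - by rewrite lee_fin; exact: (Vsq_ge0 (fun z => phi z - psi z)).
      - by rewrite -EFinM lee_fin mulr_ge0.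
      rewrite !patchE; case: ifPn => [/[1!inE] Kx|_]; last first.
        by case: ifPn => // _; rewrite -EFinM lee_fin mulr_ge0.
      rewrite mem_set; last exact: KO.
      rewrite -EFinM lee_fin ler_wpM2r//.
      by case: Kx => _ /= /le_trans; apply; rewrite ler_nat.
    apply: (@le_trans _ _ (n.+1%:R%:E * e%:E)%E); first by rewrite lee_pmul2l.
    rewrite -EFinM lee_fin mulrC -ler_pdivlMr//.
    by rewrite /e ge_min lexx orbT.
  rewrite leNgt; apply/negP => psi_small.
  have := lt_le_trans In phipsi; apply/negP; rewrite -leNgt.
  apply: (@le_trans _ _ (2%:E * ((I / 8)%:E + (I / 8)%:E))%E).
    by rewrite lee_pmul2l// leeD// ltW.
  by rewrite -EFinD -EFinM lee_fin; lra.
exists psi; split => //.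
- apply: contrapT => /forallNP psi0.
  move: denom; rewrite integral0_eq.
    by rewrite leNgt lte_fin divr_gt0.
  move=> x _; have /negP := psi0 x; rewrite negbK => /eqP ->.
  by rewrite expr0n mulr0.
move=> U UO supp.
have -> : 32 * k = (4 * (k * I)) / (I / 8) by field; rewrite gt_eqF.
apply: rayleigh_le.
- by rewrite !mulr_ge0// ltW.
- by rewrite divr_gt0.
- apply: le_trans numer; apply: le_lower_integral.
  + by move=> x _; rewrite lee_fin field_normsq_ge0.
  + by move=> x _; rewrite lee_fin field_normsq_ge0.
  + move=> x; rewrite !patchE; case: ifPn => [/[1!inE] Ux|_].
      by rewrite mem_set//; exact: UO.
    by case: ifPn => // _; rewrite lee_fin field_normsq_ge0.
- apply: le_trans denom _; apply: le_lower_integral.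
  + by move=> x /KO; rewrite lee_fin; exact: (Vsq_ge0 psi).
  + by move=> x /UO; rewrite lee_fin; exact: (Vsq_ge0 psi).
  + move=> x; rewrite !patchE; have [Ux|nUx] := pselect (U x).
      rewrite (mem_set Ux); case: ifPn => // _.
      by rewrite lee_fin; exact/(Vsq_ge0 psi)/UO.
    rewrite (memNset nUx); case: ifPn => // _.
    have -> : psi x = 0 by apply: contrapT => /eqP/supp.
    by rewrite expr0n mulr0.
Qed.

End RayleighQuotients.

(** * Chain rule along a curve *)

Lemma ler_coord_norm (R : realType) (m : nat) (v : 'rV[R]_m) (a : 'I_m) :
  `|v ord0 a| <= `|v|.
Proof.
rewrite [leRHS]/Num.Def.normr/= mx_normrE.
exact: (le_bigmax _ (fun i => `|v i.1 i.2|) (ord0, a)).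
Qed.

(** The mean value theorem between 0 and h, whatever the sign of h. *)
Lemma mean_value_at0 (R : realType) (u du : R -> R) (h : R) :
  (forall s : R, `|s| <= `|h| -> is_derive s 1 u (du s)) ->
  exists2 s, `|s| <= `|h| & u h - u 0 = du s * h.
Proof.
move=> Du.
have cu (s : R) : `|s| <= `|h| -> {for s, continuous u}.
  by move=> /Du Ds; apply: differentiable_continuous; exact/derivable1_diffP.
have cw a b : - `|h| <= a -> b <= `|h| -> {within `[a, b], continuous u}.
  move=> ha hb; apply: continuous_in_subspaceT => s; rewrite inE /= in_itv /=.
  move=> /andP[as_ sb]; apply: cu; rewrite ler_norml.
  by rewrite (le_trans ha as_) (le_trans sb hb).
have [h0|h0] := leP 0 h.
- have [||s] := @MVT_segment R u du 0 h h0.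
  + move=> s; rewrite in_itv/= => /andP[s0 sh].
    by apply: Du; rewrite !ger0_norm// ltW.
  + by apply: cw; rewrite ?ger0_norm// lerNl oppr0.
  rewrite in_itv/= subr0 => /andP[s0 sh] us.
  by exists s => //; rewrite !ger0_norm.
- have [||s] := @MVT_segment R u du h 0 (ltW h0).
  + move=> s; rewrite in_itv/= => /andP[sh s0].
    by apply: Du; rewrite !ltr0_norm// lerN2 ltW.
  + by apply: cw; rewrite ?normr_ge0// ltr0_norm// opprK.
  rewrite in_itv/= sub0r => /andP[sh s0] us.
  exists s; first by rewrite !ler0_norm// ?lerN2// ltW.
  by rewrite -opprB us mulrN opprK.
Qed.

Lemma is_derive_line (R : realType) (m : nat) (f : 'rV[R]_m -> R)
    (p v : 'rV[R]_m) (s : R) : derivable f (s *: v + p) v ->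
  is_derive s 1 (fun x : R => f (x *: v + p)) ('D_v f (s *: v + p)).
Proof.
move=> Df.
have E : (fun k : R =>
    k^-1 *: (((fun x : R => f (x *: v + p)) \o shift s) (k *: 1)
      - f (s *: v + p))) =
  (fun k : R => k^-1 *: ((f \o shift (s *: v + p)) (k *: v) - f (s *: v + p))).
  by apply/funext => k /=; rewrite scalerDl addrA [k *: 1]mulr1.
by split; rewrite /derivable /derive E.
Qed.

(** Continuous partial derivatives give the first order expansion of f at y: go
    from y to z by changing one coordinate at a time, and apply the mean value
    theorem to each of these moves. *)
Lemma increment_estimate (R : realType) (m : nat) (f : 'rV[R]_m -> R)
    (y : 'rV[R]_m) (e : R) : 0 < e ->
  (\forall z \near y, forall a, derivable f z (delta_mx ord0 a)) ->
  (forall a, {for y, continuous (partial_deriv a f)}) ->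
  \forall z \near y,
    `|f z - f y - \sum_a (z - y) ord0 a * partial_deriv a f y| <= e * `|z - y|.
Proof.
move=> e0 Df cf.
have e'0 : 0 < e / m.+1%:R by rewrite divr_gt0.
have : \forall z \near y, (forall a, derivable f z (delta_mx ord0 a)) /\
    (forall a, `|partial_deriv a f y - partial_deriv a f z| <= e / m.+1%:R).
  near=> z; split; first by near: z.
  near: z; apply: filter_forall => a.
  by move/cvgrPdist_le : (cf a) => /(_ _ e'0).
move=> /nbhs_ballP[r /= r0 fr].
apply/nbhs_ballP; exists r => //= z yz.
(* p k has already changed the first k coordinates *)
pose p (k : nat) : 'rV[R]_m :=
  \row_a (if (a < k)%N then z ord0 a else y ord0 a).
have p0 : p 0 = y by apply/rowP => a; rewrite !mxE.
have pm : p m = z by apply/rowP => a; rewrite !mxE ltn_ord.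
have -> : f z - f y = \sum_(k < m) (f (p k.+1) - f (p k)).
  rewrite -(big_mkord xpredT (fun k => f (p k.+1) - f (p k))).
  by rewrite telescope_sumr// p0 pm.
rewrite -sumrB.
apply: (@le_trans _ _ (\sum_(k < m) e / m.+1%:R * `|z - y|)); last first.
  rewrite sumr_const card_ord -mulrnAl ler_wpM2r//.
  rewrite -[leLHS]mulr_natr -mulrA ger_pMr// mulrC ler_pdivrMr// mul1r.
  by rewrite ler_nat.
apply: le_trans (ler_norm_sum _ _ _) _; apply: ler_sum => k _.
set h := (z - y) ord0 k.
have hz : `|h| <= `|z - y|.
  exact: ler_coord_norm.
have pS : p k.+1 = h *: delta_mx ord0 k + p k.
  apply/rowP => a; rewrite !mxE eqxx /= ltnS leq_eqVlt.
  case: (eqVneq a k) => [->|ak] /=.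
    by rewrite eqxx ltnn mulr1 /h !mxE subrK.
  by rewrite val_eqE (negbTE ak) /= mulr0 add0r.
have near_y s : `|s| <= `|h| -> ball y r (s *: delta_mx ord0 k + p k).
  move=> sh; rewrite -ball_normE /= in yz *.
  apply: le_lt_trans yz; rewrite [leRHS]distrC.
  rewrite [leLHS]/Num.Def.normr/= mx_normrE.
  apply: bigmax_le => // -[i a] _; rewrite (ord1 i) !mxE /=.
  case: (eqVneq a k) => [->|ak] /=.
    by rewrite ltnn mulr1 opprD addrCA subrr addr0 normrN (le_trans sh).
  rewrite mulr0 add0r; case: ifP => _; last by rewrite subrr normr0.
  by rewrite [leLHS]distrC; have := ler_coord_norm (z - y) a; rewrite !mxE.
have [|s sh E] := @mean_value_at0 R (fun s => f (s *: delta_mx ord0 k + p k))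
    (fun s => partial_deriv k f (s *: delta_mx ord0 k + p k)) h.
  by move=> s /near_y/fr[+ _] => /(_ k) Ds; exact: is_derive_line.
rewrite pS; rewrite scale0r add0r in E; rewrite E mulrC -mulrBr normrM mulrC.
apply: ler_pM => //.
by rewrite distrC; have [_] := fr _ (near_y _ sh); exact.
Unshelve. all: by end_near. Qed.

Lemma is_derive_comp_partial (R : realType) (m : nat) (f : 'rV[R]_m -> R)
    (c : R -> 'rV[R]_m) (t : R) :
  (\forall z \near c t, forall a, derivable f z (delta_mx ord0 a)) ->
  (forall a, {for c t, continuous (partial_deriv a f)}) ->
  derivable c t 1 ->
  is_derive t 1 (f \o c)
    (\sum_a (derive1 c t) ord0 a * partial_deriv a f (c t)).
Proof.
move=> Df cf Dc.
set v := derive1 c t.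
have cc : {for t, continuous c}.
  by apply: differentiable_continuous; exact/derivable1_diffP.
have Dv : (fun k : R => k^-1 *: ((c \o shift t) (k *: 1) - c t)) @ 0^' --> v.
  by rewrite /v derive1E.
set l := \sum_a _.
suff L : (fun k : R =>
    k^-1 *: (((f \o c) \o shift t) (k *: 1) - (f \o c) t)) @ 0^' --> l.
  split; first by apply/cvg_ex; exists l.
  exact: cvg_lim.
have shift0 : (k *: 1 + t : R) @[k --> 0^'] --> t.
  rewrite -[X in _ --> X]add0r; apply: cvgD; last exact: cvg_cst.
  rewrite (_ : (fun k : R => k *: 1) = id); first exact: nbhs_dnbhs.
  by apply/funext => k; rewrite /= [LHS]mulr1.
pose F := \sum_a `|partial_deriv a f (c t)|.
apply/cvgrPdist_le => /= e e0.
pose e1 := e / 2 / (`|v| + 1).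
pose e2 := e / 2 / (F + 1).
have F0 : 0 <= F by exact: sumr_ge0.
have v1 : 0 < `|v| + 1 by rewrite ltr_wpDl.
have F1 : 0 < F + 1 by rewrite ltr_wpDl.
have e10 : 0 < e1 by rewrite !divr_gt0.
have e20 : 0 < e2 by rewrite !divr_gt0.
near=> k.
have k0 : k != 0 by near: k; exact: nbhs_dnbhs_neq.
have est : `|f (c (k *: 1 + t)) - f (c t) - \sum_a (c (k *: 1 + t) - c t) ord0 a
     * partial_deriv a f (c t)| <= e1 * `|c (k *: 1 + t) - c t|.
  near: k.
  exact: (cvg_comp _ _ shift0 cc _ (increment_estimate e10 Df cf)).
(* q is the difference quotient of c, close to its velocity v *)
have : `|v - k^-1 *: (c (k *: 1 + t) - c t)| <= Num.min 1 e2.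
  near: k; move/cvgrPdist_le : Dv => /(_ (Num.min 1 e2)); apply.
  by rewrite lt_min ltr01.
set q : 'rV[R]_m := k^-1 *: (c (k *: 1 + t) - c t) => qv.
have qv1 : `|v - q| <= 1 by rewrite (le_trans qv)// ge_min lexx.
have qv2 : `|v - q| <= e2 by rewrite (le_trans qv)// ge_min lexx orbT.
have q1 : `|q| <= `|v| + 1.
  rewrite -[q](subrK v) addrC (le_trans (ler_normD _ _))// lerD2l.
  by rewrite distrC.
have cq : c (k *: 1 + t) - c t = k *: q by rewrite scalerA divff// scale1r.
have -> : l - k^-1 *: (f (c (k *: 1 + t)) - f (c t)) =
  \sum_a (v - q) ord0 a * partial_deriv a f (c t)
  - k^-1 * (f (c (k *: 1 + t)) - f (c t) - \sum_a (c (k *: 1 + t) - c t) ord0 a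
     * partial_deriv a f (c t)).
  rewrite cq [in RHS]mulrBr opprB addrA; congr (_ - _).
  rewrite mulr_sumr -big_split; apply: eq_bigr => a _.
  by rewrite !mxE /=; field.
rewrite (le_trans (ler_normB _ _))// (splitr e) lerD//.
- apply: (@le_trans _ _ (e2 * F)).
    rewrite mulr_sumr (le_trans (ler_norm_sum _ _ _))//; apply: ler_sum => a _.
    rewrite normrM ler_wpM2r// (le_trans _ qv2)//.
    exact: ler_coord_norm.
  rewrite /e2 mulrAC ler_pdivrMr// ler_wpM2l//; last by rewrite lerDl.
  by rewrite divr_ge0// ltW.
- rewrite normrM normfV ler_pdivrMl ?normr_gt0//.
  apply: (le_trans est); rewrite cq normrZ mulrCA ler_wpM2l//.
  apply: (@le_trans _ _ (e1 * (`|v| + 1))); first by rewrite ler_wpM2l// ltW.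
  by rewrite /e1 divfK// gt_eqF.
Unshelve. all: by end_near. Qed.

(** * Two facts on functions of one variable *)

(** If P is a primitive of sp, then u - K P is nonincreasing. *)
Lemma increment_le_integral (R : realType) (u sp : R -> R) (K : R) :
  (forall t, 0 <= t <= 1 -> derivable u t 1) ->
  (forall t, 0 <= t <= 1 -> {for t, continuous sp}) ->
  (forall t, 0 <= t <= 1 -> derive1 u t <= K * sp t) ->
  u 1 - u 0 <= K * Rintegral (@lebesgue_measure R) `[0, 1]%classic sp.
Proof.
move=> Du csp usp.
have oo (t : R) : t \in `]0, 1[%R -> 0 <= t <= 1.
  by rewrite in_itv/= => /andP[t0 t1]; rewrite !ltW.
have sp_int : (@lebesgue_measure R).-integrable `[0, 1]%classic (EFin \o sp).
  apply: continuous_compact_integrable; first exact: segment_compact.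
  apply: continuous_in_subspaceT => t; rewrite inE/= in_itv/=; exact: csp.
pose F x := Rintegral (@lebesgue_measure R) `[0, x]%classic sp.
have cF : {within `[0, 1], continuous F}.
  exact: (parameterized_integral_continuous ler01 sp_int).
have DF (t : R) : t \in `]0, 1[%R -> derivable F t 1 /\ derive1 F t = sp t.
  move=> t01; have := t01; rewrite in_itv /= => /andP[t0 t1].
  by apply: (continuous_FTC1_closed t1 sp_int t0); apply: csp; exact: oo.
have F0 : F 0 = 0 by rewrite /F set_itv1 Rintegral_set1.
pose w : R -> R := u - (K \*: F).
have Dw (t : R) : t \in `]0, 1[%R -> is_derive t 1 w (derive1 u t - K * sp t).
  move=> t01; have [DFt <-] := DF _ t01.
  rewrite !derive1E; apply: is_deriveB.
    by apply: derivableP; exact/Du/oo.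
  by apply: is_deriveZ; exact: derivableP.
have := @ler0_derive1_le_cc R w 0 1.
have -> : (u 1 - u 0 <= K * F 1) = (w 1 <= w 0).
  by rewrite /w !fctE /= F0 scaler0 subr0 lerBlDr lerBlDl.
apply => //; rewrite ?in_itv/= ?lexx ?ler01//.
- by move=> t /Dw[].
- move=> t t01; rewrite derive1E; have [_ ->] := Dw _ t01.
  by rewrite subr_le0 usp// oo.
- have cu : {within `[0, 1], continuous u}.
    apply: continuous_in_subspaceT => t; rewrite inE/= in_itv/= => t01.
    by apply: differentiable_continuous; apply/derivable1_diffP; exact: Du.
  move=> t.
  by apply: cvgB; [exact: (cu t)|apply: cvgZr; exact: (cF t)].
Qed.

(** Squaring makes the positive part differentiable at 0; this is the profile of
    the bump functions below. *)
Lemma is_derive_pos_sq (R : realType) (s : R) :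
  is_derive s 1 (fun x : R => Num.max 0 x ^+ 2) (2 * Num.max 0 s).
Proof.
case: (ltgtP s 0) => [s0|s0|->].
- rewrite mulr0.
  apply: (near_eq_is_derive (f := cst 0)).
  near=> x; rewrite /cst max_l ?expr0n//= ltW//.
  near: x; exact: lt_nbhsl.
- have D2 : is_derive s 1 (fun x : R => x ^+ 2) (2 * s).
    have := @is_deriveX R R id 2 s 1 1 (is_derive_id _ _).
    by rewrite /= expr1 /GRing.scale /= mulr1.
  apply: near_eq_is_derive D2.
  near=> x; rewrite max_r// ltW//.
  near: x; exact: lt_nbhsr.
- rewrite ?maxxx mulr0.
  suff L : (fun k : R =>
      k^-1 *: (((fun x : R => Num.max 0 x ^+ 2) \o shift 0) (k *: 1)
      - Num.max 0 (0 : R) ^+ 2)) @ 0^' --> (0 : R).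
    split; first by apply/cvg_ex; exists 0.
    exact: cvg_lim.
  apply/cvgrPdist_le => e e0; near=> k.
  have k0 : k != 0 by near: k; exact: nbhs_dnbhs_neq.
  rewrite sub0r normrN maxxx expr0n/= subr0 addr0 normrM normfV.
  rewrite ler_pdivrMl ?normr_gt0// /GRing.scale/= mulr1 normrX.
  have mk : `|Num.max 0 k| <= `|k|.
    by rewrite ger0_norm ?le_max ?lexx// ge_max normr_ge0 ler_norm.
  rewrite expr2 ler_pM// (le_trans mk)//.
  by near: k; apply: dnbhs0_le.
Unshelve. all: by end_near. Qed.

(** * Speed of curves *)

Section Curves.
Context (R : realType) (m : nat) (M : ptopologicalType).
Context (S : smooth_manifold R m M) (g : riemannian_metric S).

Local Notation dom := (@chart_dom R m M S).
Local Notation chart := (@chart_map R m M S).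
Local Notation inv := (@chart_inv R m M S).

Lemma near_chart_dom i x : dom i x -> \forall z \near x, dom i z.
Proof.
by move=> ix; apply: open_nbhs_nbhs; split => //; exact: chart_dom_open.
Qed.

Lemma near_chart_overlap i j x : dom i x -> dom j x ->
  \forall y \near chart i x, (chart i @` (dom i `&` dom j)) y.
Proof.
move=> ix jx.
have cod : \forall y \near chart i x, (chart i @` dom i) y.
  by apply: open_nbhs_nbhs; split; [exact: chart_cod_open|exists x].
have inv_j : \forall y \near chart i x, dom j (inv i y).
  by apply: (chart_inv_cont ix); rewrite (chart_mapK ix); exact: near_chart_dom.
near=> y.
have [z iz zy] : (chart i @` dom i) y by near: y.
exists z => //; split=> //; rewrite -(chart_mapK iz) zy.
by near: y.
Unshelve. all: by end_near. Qed.

Lemma curve_chart_change i j (c : R -> M) t :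
  {for t, continuous c} -> dom i (c t) -> dom j (c t) ->
  derivable (chart i \o c) t 1 ->
  derivable (chart j \o c) t 1 /\
  derive1 (chart j \o c) t =
    derive1 (chart i \o c) t *m transition_jac i j (c t).
Proof.
move=> cc ic jc Dc.
have coord b : is_derive t 1 (fun s => chart j (c s) ord0 b)
    (\sum_a derive1 (chart i \o c) t ord0 a *
       transition_jac i j (c t) a b).
  pose T y := chart j (inv i y) ord0 b.
  have ov := near_chart_overlap ic jc.
  have ovt : (chart i @` (dom i `&` dom j)) (chart i (c t)).
    exact: nbhs_singleton ov.
  apply: (near_eq_is_derive (f := T \o (chart i \o c))).
    have : \forall s \near t, dom i (c s) by apply: cc; exact: near_chart_dom.
    by apply: filterS => s ics; rewrite /T /= chart_mapK.
  under eq_bigr do rewrite mxE.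
  apply: is_derive_comp_partial => //.
    apply: filterS ov => y ovy a.
    by have [+ _] := chart_transition_smooth b [::] ovy; exact.
  by move=> a; have [_] := chart_transition_smooth b [:: a] ovt.
have Dj : derivable (chart j \o c) t 1.
  by apply/derivable_mxP => i0 b; rewrite (ord1 i0); have [] := coord b.
split=> //; rewrite !derive1E (derive_mx Dj); apply/rowP => b; rewrite !mxE.
by have [_ /= ->] := coord b; rewrite derive1E.
Qed.

Lemma speed_chart i (c : R -> M) t :
  {for t, continuous c} -> dom i (c t) ->
  derivable (chart i \o c) t 1 ->
  speed g c t = Num.sqrt (qform (metric_coef g i (c t))
    (derive1 (chart i \o c) t)).
Proof.
move=> cc ic Dc; have jc := chart_at_dom S (c t).
rewrite /speed /inner -/(qform _ _).
by have [_ ->] := curve_chart_change cc ic jc Dc; rewrite qform_transition.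
Qed.

(** Continuity of c is known at t only.  At nearby parameters it follows from
    the differentiability of the coordinates of c. *)
Lemma near_regular_curve (c : R -> M) i t : {for t, continuous c} ->
  dom i (c t) ->
  (\forall s \near t, derivable (chart i \o c) s 1) ->
  \forall s \near t, [/\ {for s, continuous c}, dom i (c s) &
    derivable (chart i \o c) s 1].
Proof.
move=> cc ic Dc.
have nic : \forall s \near t, dom i (c s).
  by apply: cc; exact: near_chart_dom.
near=> s.
have Ds : derivable (chart i \o c) s 1 by near: s.
have ics : dom i (c s) by near: s.
split=> //.
have cs : {for s, continuous (chart i \o c)}.
  by apply: differentiable_continuous; exact/derivable1_diffP.
have cinv : inv i (chart i (c z)) @[z --> s] --> c s.
  rewrite -[in X in _ --> X](chart_mapK ics).
  by apply: (continuous_comp cs); exact: chart_inv_cont.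
apply: cvg_trans cinv.
apply: near_eq_cvg.
have : \forall s' \near s, dom i (c s') by near: s; exact: (near_join nic).
by apply: filterS => s' ics' /=; rewrite chart_mapK.
Unshelve. all: by end_near. Qed.

Lemma speed_continuous (c : R -> M) t : C1_curve S c -> 0 <= t <= 1 ->
  {for t, continuous (speed g c)}.
Proof.
move=> C1 t01; have [cc C1t] := C1 t t01.
set i := chart_at S (c t); have ic : dom i (c t) := chart_at_dom S (c t).
have [Dc cDc] := C1t i ic.
have reg := near_regular_curve cc ic Dc.
have [_ _ Dct] := nbhs_singleton reg.
pose h s := Num.sqrt (qform (metric_coef g i (c s))
    (derive1 (chart i \o c) s)).
have ch : {for t, continuous h}.
  apply: (continuous_comp (g := Num.sqrt)); last exact: sqrt_continuous.
  apply: qform_continuous => [a b|a].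
    apply: (continuous_comp (g := fun z => metric_coef g i z a b)) => //.
    exact: metric_coef_continuous.
  apply: (@continuous_comp _ _ _ (derive1 (chart i \o c))
    (fun v : 'rV[R]_m => v ord0 a) t cDc).
  exact: (@coord_continuous R 1 m ord0 a).
have E : speed g c t = h t := speed_chart cc ic Dct.
have -> : {for t, continuous (speed g c)} = (speed g c s @[s --> t] --> h t).
  by rewrite -E.
have hs : \forall s \near t, h s = speed g c s.
  by apply: filterS reg => s [cs ics Ds]; exact/esym/speed_chart.
exact: cvg_trans (near_eq_cvg hs) ch.
Qed.

End Curves.

(** * Riemannian distance to the complement of an open set *)

Section Distance.
Context (R : realType) (m : nat) (M : ptopologicalType).
Context (S : smooth_manifold R m M) (g : riemannian_metric S).
Local Notation dom := (@chart_dom R m M S).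
Local Notation chart := (@chart_map R m M S).
Local Notation inv := (@chart_inv R m M S).

(** The metric is positive on the product of K with the unit sphere, which is
    compact, hence bounded below there by some c; homogeneity does the rest. *)
Lemma metric_lower_bound i (K : set 'rV[R]_m) :
  compact K -> K `<=` chart_cod i ->
  exists2 c : R, 0 < c & forall x v, dom i x -> K (chart i x) ->
    c * `|v| ^+ 2 <= qform (metric_coef g i x) v.
Proof.
move=> cK Kcod.
pose sphere := [set v : 'rV[R]_m | `|v| = 1].
have c_sphere : compact sphere.
  apply: bounded_closed_compact.
    exists 1; split=> // x x1 v /= ->; exact: ltW.
  rewrite (_ : sphere = (fun v : 'rV[R]_m => `|v|) @^-1` [set 1]) //.
  by apply: closed_comp => // v _; exact: norm_continuous.
pose F (p : 'rV[R]_m * 'rV[R]_m) := qform (metric_coef g i (inv i p.1)) p.2.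
have normalize (v : 'rV[R]_m) : v != 0 -> sphere (`|v|^-1 *: v).
  move=> v0; rewrite /sphere/= normrZ ger0_norm ?invr_ge0//.
  by rewrite mulVf// normr_eq0.
(* the sphere is empty when m = 0 *)
have [nonempty|empty] := pselect ((K `*` sphere) !=set0); last first.
  exists 1 => // x v ix Kx; have [->|v0] := eqVneq v 0.
    by rewrite normr0 expr0n mulr0 /qform !mul0mx mxE.
  case: empty; exists (chart i x, `|v|^-1 *: v); split => //; exact: normalize.
have cF : {within K `*` sphere, continuous F}.
  apply: continuous_in_subspaceT => -[y v].
  rewrite inE => -[/= /Kcod[x ix xy] _].
  apply: qform_continuous => [a b|a].
    apply: (@continuous_comp _ _ _ (fun p : 'rV[R]_m * 'rV[R]_m => p.1)
      (fun y => metric_coef g i (inv i y) a b) (y, v)); first exact: cvg_fst.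
    rewrite /= -xy.
    by have [] := metric_smooth g a b [::] (imageP _ ix).
  apply: (@continuous_comp _ _ _ (fun p : 'rV[R]_m * 'rV[R]_m => p.2)
      (fun v : 'rV[R]_m => v ord0 a) (y, v)); first exact: cvg_snd.
  exact: (@coord_continuous R 1 m ord0 a).
have [[y0 v0]] := compact_EVT_min nonempty (compact_setX cK c_sphere) cF.
rewrite inE => -[/= /Kcod[x0 ix0 xy0] v01] minF.
exists (F (y0, v0)).
  rewrite /F/= -xy0 (chart_mapK ix0); apply: metric_posdef => //.
  apply/eqP => v00; move: v01; rewrite /sphere/= v00 normr0 => /eqP.
  by rewrite eq_sym oner_eq0.
move=> x v ix Kx; have [->|vn0] := eqVneq v 0.
  by rewrite normr0 expr0n mulr0 /qform !mul0mx mxE.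
have nv0 : `|v| != 0 by rewrite normr_eq0.
rewrite -[in leRHS](scale1r v) -[in leRHS](mulfV nv0) -scalerA qformZ mulrC.
rewrite ler_wpM2l ?sqr_ge0//.
have := minF (chart i x, `|v|^-1 *: v); rewrite {2}/F /= chart_mapK//; apply.
by rewrite inE; split => //; exact: normalize.
Qed.

(** In the coordinates y of a chart around x0, with center y0, the function is
    h = max (0, r^2 - |y - y0|^2)^2, with the Euclidean norm, extended by 0, and
    r is so small that h vanishes outside a compact cube of coordinates
    contained in W.  Along a curve its derivative is at most 4 r^3 m |v|, with
    |v| the maximum norm of the velocity in the chart, and |v| is at most a
    constant times the speed by [metric_lower_bound]. *)
Lemma bump_function (W : set M) (x0 : M) : open W -> W x0 ->
  exists (h : M -> R) (K : R), [/\ 0 < K, 0 < h x0, {for x0, continuous h},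
    (forall z, ~ W z -> h z = 0) &
    forall c t, C1_curve S c -> 0 <= t <= 1 ->
      derivable (h \o c) t 1 /\ `|derive1 (h \o c) t| <= K * speed g c t].
Proof.
move=> oW Wx0; set i := chart_at S x0; set y0 := chart i x0.
have ix0 : dom i x0 := chart_at_dom S x0.
have : \forall y \near y0, chart_cod i y /\ W (inv i y).
  apply: filterI.
    by apply: open_nbhs_nbhs; split; [exact: chart_cod_open|exists x0].
  apply: (chart_inv_cont ix0); rewrite (chart_mapK ix0).
  exact: open_nbhs_nbhs.
move=> /nbhs_ballP[r0 /= r00 yW].
have [r r_gt0 r_lt] : exists2 r, 0 < r & r < r0.
  by exists (r0 / 2); rewrite ?divr_gt0// ltr_pdivrMr// ltr_pMr// ltr1n.
pose cube := [set y : 'rV[R]_m |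
  forall a, `[y0 ord0 a - r, y0 ord0 a + r]%classic (y ord0 a)].
have c_cube : compact cube.
  apply: (@rV_compact R m
    (fun a => `[y0 ord0 a - r, y0 ord0 a + r]%classic)) => a.
  exact: segment_compact.
have cubeE y : cube y <-> forall a, `|y ord0 a - y0 ord0 a| <= r.
  by split=> H a; have := H a; rewrite /= in_itv/= ler_distl.
have cube_ball y : cube y -> chart_cod i y /\ W (inv i y).
  move=> /cubeE yr; apply: yW; rewrite -ball_normE /=.
  rewrite (@le_lt_trans _ _ r)//.
  rewrite [leLHS]/Num.Def.normr/= mx_normrE; apply: bigmax_le; first exact: ltW.
  by move=> -[j a] _; rewrite (ord1 j) !mxE distrC.
have [c0 c0_gt0 lower] : exists2 c : R, 0 < c & forall x v, dom i x ->
    cube (chart i x) -> c * `|v| ^+ 2 <= qform (metric_coef g i x) v.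
  by apply: metric_lower_bound => // y /cube_ball[].
pose q (y : 'rV[R]_m) := r ^+ 2 - \sum_a (y ord0 a - y0 ord0 a) ^+ 2.
pose h z : R := if `[< dom i z >] then Num.max 0 (q (chart i z)) ^+ 2 else 0.
have hE z : dom i z -> h z = Num.max 0 (q (chart i z)) ^+ 2.
  by move=> iz; rewrite /h asboolT.
have q_cube y : 0 < q y -> cube y.
  rewrite /q subr_gt0 => qy; apply/cubeE => a.
  rewrite -ler_sqr ?nnegrE ?(ltW r_gt0)// real_normK ?num_real//.
  rewrite (le_trans _ (ltW qy))//.
  by rewrite (bigD1 a)//= lerDl sumr_ge0// => b _; exact: sqr_ge0.
have h_supp z : h z != 0 -> dom i z /\ cube (chart i z).
  rewrite /h; case: asboolP => [iz|_]; last by rewrite eqxx.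
  move=> h0; split=> //; apply: q_cube; rewrite ltNge; apply: contra h0 => q0.
  by rewrite max_l// expr0n.
(* M is Hausdorff: h is locally 0 at the points outside the compact cube,
   including those on the boundary of the chart domain *)
have closed_supp : closed (inv i @` cube).
  apply: compact_closed; first exact: (manifold_hausdorff S).
  apply: continuous_compact => //; apply: continuous_in_subspaceT => y.
  by rewrite inE => /cube_ball[[x ix <-] _]; exact: chart_inv_cont.
(* 1 is added to have K > 0 also when m = 0 *)
pose K := 4 * r ^+ 3 * m%:R / Num.sqrt c0 + 1.
have sc0 : 0 < Num.sqrt c0 by rewrite sqrtr_gt0.
have K_gt0 : 0 < K.
  rewrite ltr_wpDl// divr_ge0 ?(ltW sc0)// mulr_ge0// mulr_ge0//.
  by rewrite ltW// exprn_gt0.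
exists h, K; split => //.
- rewrite hE// /q big1 ?subr0; last by move=> a _; rewrite subrr expr0n.
  by rewrite max_r ?sqr_ge0// !exprn_gt0.
- apply: (chart_continuous ix0).
  have -> : {for chart i x0, continuous (h \o inv i)} =
      (h (inv i y) @[y --> y0] --> Num.max 0 (q y0) ^+ 2).
    by rewrite -(hE _ ix0) -[in h x0](chart_mapK ix0).
  have cq : {for y0, continuous q}.
    have ca a : (y ord0 a - y0 ord0 a) ^+ 2 @[y --> y0] -->
        (y0 ord0 a - y0 ord0 a) ^+ 2.
      have cb : y ord0 a - y0 ord0 a @[y --> y0] --> y0 ord0 a - y0 ord0 a.
        apply: cvgB; last exact: cvg_cst.
        exact: (@coord_continuous R 1 m ord0 a).
      by rewrite expr2; exact: (cvgM cb cb).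
    have c1 : (fun=> r ^+ 2 : R) @ (nbhs y0) --> (r ^+ 2 : R) by apply: cvg_cst.
    have c2 := @continuous_sum_at R _ _ (fun a (y : 'rV[R]_m) =>
      (y ord0 a - y0 ord0 a) ^+ 2) y0 ca.
    exact: (cvgB c1 c2).
  have cG : {for q y0, continuous (fun s : R => Num.max 0 s ^+ 2)}.
    apply: differentiable_continuous; apply/derivable1_diffP.
    by have [] := is_derive_pos_sq (q y0).
  have cod_near : \forall y \near y0, chart_cod i y.
    by apply: open_nbhs_nbhs; split; [exact: chart_cod_open|exists x0].
  have hq : \forall y \near y0,
      ((fun s : R => Num.max 0 s ^+ 2) \o q) y = h (inv i y).
    near=> y; have [z iz <-] : chart_cod i y by near: y.
    by rewrite /= chart_mapK// hE.
  exact: (cvg_trans (near_eq_cvg hq) (continuous_comp cq cG)).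
- move=> z nWz; apply/eqP; apply: contrapT => /negP/h_supp[iz /cube_ball[_]].
  by rewrite chart_mapK.
move=> c t C1 t01; have [cc C1t] := C1 t t01.
have [[y cy yct]|nsupp] := pselect ((inv i @` cube) (c t)); last first.
  have D0 : is_derive t 1 (h \o c) 0.
    apply: (near_eq_is_derive (f := cst 0)).
    have : \forall s \near t, ~ (inv i @` cube) (c s).
      have out : nbhs (c t) (~` (inv i @` cube)).
        by apply: open_nbhs_nbhs; split => //; exact: closed_openC.
      exact: (cc _ out).
    apply: filterS => s nsupp_s; apply/esym/eqP; apply: contrapT => /negP.
    move=> /h_supp[ics cubes]; apply: nsupp_s.
    by exists (chart i (c s)) => //; exact: chart_mapK.
  split; first by case: D0.
  rewrite derive1E; case: D0 => _ ->.
  by rewrite normr0 mulr_ge0// ?(ltW K_gt0)// sqrtr_ge0.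
have [ict cube_ct] : dom i (c t) /\ cube (chart i (c t)).
  have [[x ix xy] _] := cube_ball _ cy.
  by rewrite -yct -xy (chart_mapK ix) xy.
have [Dc _] := C1t i ict.
have reg := near_regular_curve cc ict Dc.
have [_ _ Dct] := nbhs_singleton reg.
set v := derive1 (chart i \o c) t.
pose dq := - \sum_a 2 * (chart i (c t) ord0 a - y0 ord0 a) * v ord0 a.
pose f a (s : R) : R := chart i (c s) ord0 a - y0 ord0 a.
have Df a : is_derive t 1 (f a) (v ord0 a).
  have Da : derivable (fun s : R => chart i (c s) ord0 a) t 1.
    by move/derivable_mxP : Dct => /(_ ord0 a).
  have := is_deriveB (derivableP Da) (is_derive_cst (y0 ord0 a) t 1).
  by rewrite subr0 /v derive1E (derive_mx Dct) mxE.
have Dq : is_derive t 1 (fun s => q (chart i (c s))) dq.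
  have Df2 a : is_derive t 1 (f a ^+ 2)
      (2 * (chart i (c t) ord0 a - y0 ord0 a) * v ord0 a).
    by have := is_deriveX 2 (Df a); rewrite /= expr1.
  have := is_deriveB (is_derive_cst (r ^+ 2) t 1) (is_derive_sum Df2).
  rewrite sub0r; congr (is_derive t 1 _ _).
  by apply/funext => s; rewrite !fctE fct_sumE.
have D : is_derive t 1 (h \o c) (2 * Num.max 0 (q (chart i (c t))) * dq).
  have := @is_derive1_comp R (fun s : R => Num.max 0 s ^+ 2)
    (fun s : R => q (chart i (c s))) t _ _ (is_derive_pos_sq _) Dq.
  apply: near_eq_is_derive; apply: filterS reg => s [_ ics _] /=.
  by rewrite hE.
split; first by case: D.
rewrite derive1E; case: D => _ ->.
rewrite (speed_chart g cc ict Dct) -/v.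
have vQ : Num.sqrt c0 * `|v| <= Num.sqrt (qform (metric_coef g i (c t)) v).
  rewrite -[`|v|]ger0_norm// -sqrtr_sqr -sqrtrM ?(ltW c0_gt0)//.
  by rewrite ler_wsqrtr// lower.
apply: (@le_trans _ _ (K * (Num.sqrt c0 * `|v|))); last first.
  by rewrite ler_wpM2l// ltW.
apply: (@le_trans _ _ (4 * r ^+ 3 * m%:R * `|v|)); last first.
  rewrite [leRHS]mulrA ler_wpM2r//.
  by rewrite [leRHS]mulrDl mul1r divfK ?gt_eqF// lerDl ltW.
have qmax : 0 <= Num.max 0 (q (chart i (c t))) <= r ^+ 2.
  rewrite le_max lexx ge_max sqr_ge0 /q lerBlDr lerDl sumr_ge0// => a _.
  exact: sqr_ge0.
have dq_le : `|dq| <= 2 * r * m%:R * `|v|.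
  rewrite normrN (le_trans (ler_norm_sum _ _ _))//.
  apply: (@le_trans _ _ (\sum_(a < m) 2 * r * `|v|)).
    apply: ler_sum => a _.
    rewrite !normrM (@ger0_norm _ 2)// -!mulrA ler_pM2l//.
    rewrite ler_pM//; first exact: ((cubeE _).1 cube_ct).
    exact: ler_coord_norm.
  by rewrite sumr_const card_ord -[leLHS]mulr_natr mulrAC.
case/andP: qmax => q0 qr.
rewrite !normrM ger0_norm// [X in _ * X * _]ger0_norm//.
apply: (@le_trans _ _ (2 * r ^+ 2 * (2 * r * m%:R * `|v|))).
  by rewrite ler_pM ?mulr_ge0// ler_wpM2l.
by rewrite le_eqVlt; apply/orP; left; apply/eqP; ring.
Unshelve. all: by end_near. Qed.

(** Induction on the number of C^1 arcs of a path from x to y. *)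
Lemma joined_lipschitz (h : M -> R) (K : R) x y l :
  (forall c t, C1_curve S c -> 0 <= t <= 1 ->
    derivable (h \o c) t 1 /\ `|derive1 (h \o c) t| <= K * speed g c t) ->
  joined g x y l -> h x - h y <= K * l.
Proof.
move=> hK; elim=> {x y l} [x|c y l C1 _ IH].
  by rewrite subrr mulr0.
rewrite mulrDr -(subrKA (h (c 1))) lerD//.
have := @increment_le_integral R (- (h \o c)) (speed g c) K.
rewrite !fctE /= opprK addrC; apply.
- by move=> t t01; apply: derivableN; have [] := hK c t C1 t01.
- by move=> t t01; exact: speed_continuous.
- move=> t t01; have [D le] := hK c t C1 t01.
  rewrite derive1E deriveN// -derive1E (le_trans _ le)//.
  by rewrite -normrN ler_norm.
Qed.

(** Close to x the bump function is at least half of its value at x, a drop that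
    any path leaving W has to pay for by its length. *)
Lemma dist_complement_gt0 (W : set M) (x : M) : open W -> W x ->
  exists2 d : R, 0 < d &
    \forall y \near x, forall z, ~ W z -> (d%:E <= dist g y z)%E.
Proof.
move=> oW Wx; have [h [K [K0 hx0 ch hW hK]]] := bump_function oW Wx.
exists (h x / 2 / K); first by rewrite !divr_gt0.
have : \forall y \near x, h x / 2 < h y.
  by apply: (cvgr_gt (h x)) => //; rewrite ltr_pdivrMr// ltr_pMr// ltr1n.
apply: filterS => y hy z nWz; apply: le_ereal_inf_tmp => _ [l ly <-].
rewrite lee_fin ler_pdivrMr// [leRHS]mulrC (le_trans (ltW hy))//.
by have := joined_lipschitz hK ly; rewrite (hW _ nWz) subr0.
Qed.

End Distance.

(** * Test functions of the inner domains *)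

Section InnerDomain.
Context (R : realType) (m : nat) (M : ptopologicalType).
Context (S : smooth_manifold R m M) (g : riemannian_metric S).

(** Each point of the support of psi has a neighborhood that misses all collars
    of small width; by compactness one width works for the whole support. *)
Lemma Cc_smooth_inner_domain (Omega : set M) (psi : M -> R) :
  open Omega -> Cc_smooth S Omega psi ->
  \forall delta \near (0 : R)^'+, Cc_smooth S (inner_domain g Omega delta) psi.
Proof.
move=> oO [psi_smooth cpt suppO].
suff : \forall delta \near (0 : R)^'+, closure [set x | psi x != 0] `<=`
    (fun x => ~ closure (collar g Omega delta) x).
  apply: filterS => delta away; split=> // x Kx.
  by split; [exact: suppO|exact: away].
apply: (iffLR (compact_near_coveringP _) cpt) => x /suppO Ox.
have [d d0 far] := dist_complement_gt0 g oO Ox.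
have far' := near_join far.
exists ([set y | \forall y' \near y, forall z, ~ Omega z ->
    (d%:E <= dist g y' z)%E], [set delta | delta < d]).
  by split => //=; exact: nbhs_right_lt.
move=> [y delta] [/= fary deltad] /(_ _ fary)[y' [[_ close]]] fary'.
move: close; apply/negP; rewrite -leNgt.
apply: (@le_trans _ _ d%:E); first by rewrite lee_fin ltW.
apply: le_ereal_inf_tmp => _ [z [_ nOz] <-]; apply: fary'.
by move=> Oz; apply: nOz; apply: open_nbhs_nbhs.
Qed.

End InnerDomain.

(** * Vanishing of the limit of the first eigenvalues *)

Theorem lemma4p2 (R : realType) (m : nat) (M : ptopologicalType)
  (S : smooth_manifold R m M) (g : riemannian_metric S)
  (mu : {measure set (borel M) -> \bar R}) (mu_riem : riemannian_measure g mu)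
  (Omega : set M) (Omega_open : open Omega)
  (Omega_relcompact : compact (closure Omega))
  (Omega_connected : connected Omega)
  (V : M -> R) (V_cont : {within Omega, continuous V})
  (V_pos : forall x, Omega x -> 0 < V x)
  (test_functions : exists C : R, 0 < C /\
    forall alpha : R, 0 < alpha ->
      exists (phi : M -> R) (gradphi : field S),
        [/\ W12_0 g mu Omega phi gradphi,
            L2_weighted mu Omega V phi,
            ~ {ae mu, forall x, Omega x -> phi x = 0},
            (\int[mu]_(x in Omega) (field_normsq g gradphi x)%:E <=
               (C * alpha)%:E * \int[mu]_(x in Omega) (V x * phi x ^+ 2)%:E)%E &
            (fun delta : R => Rintegral mu
               (collar g Omega (2 * delta) `\` collar g Omega delta)
               (fun x => `|phi x| ^+ 2))
              =o_ ((0 : R)^'+) (fun delta : R => delta ^+ 2)]) :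
  first_eigenvalue g mu (inner_domain g Omega delta) V
    @[delta --> (0 : R)^'+] --> 0%E.
Proof.
have V_ge0 delta x : inner_domain g Omega delta x -> 0 <= V x.
  by move=> [Ox _]; exact/ltW/V_pos.
have eigen_ge0 delta :
    (0 <= first_eigenvalue g mu (inner_domain g Omega delta) V)%E.
  apply: le_ereal_inf_tmp => _ [psi _ <-]; rewrite lee_fin.
  by apply: rayleigh_ge0 => x; exact: V_ge0.
have eigen_small (e : R) : 0 < e -> \forall delta \near (0 : R)^'+,
    (first_eigenvalue g mu (inner_domain g Omega delta) V <= e%:E)%E.
  move=> e0; have [C [C0 /(_ (e / (32 * C)))]] := test_functions.
  case=> [|phi [gradphi [phiW phiV phi0 energy _]]].
    by rewrite divr_gt0// mulr_gt0.
  have kE : 32 * (C * (e / (32 * C))) = e by field; rewrite gt_eqF.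
  have k0 : 0 < C * (e / (32 * C)) by rewrite mulr_gt0// divr_gt0// mulr_gt0.
  have [psi [psiC psi0 psi_le]] :=
    test_function Omega_open V_cont V_pos k0 phiW phiV phi0 energy.
  have := Cc_smooth_inner_domain g Omega_open psiC.
  apply: filterS => delta psiU.
  apply: (@le_trans _ _ (rayleigh g mu (inner_domain g Omega delta) V psi)%:E).
    by apply: ereal_inf_lbound; exists psi.
  rewrite lee_fin -kE; apply: psi_le; first by move=> x [].
  by case: psiU => _ _ suppU x psix; apply: suppU; exact: subset_closure.
apply/fine_cvgP; split.
  have := eigen_small 1 ltr01; apply: filterS => delta le1.
  by rewrite ge0_fin_numE// (le_lt_trans le1)// ltry.
apply/cvgrPdist_le => e e0; have := eigen_small e e0.
apply: filterS => delta le_e.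
rewrite sub0r normrN ger0_norm; last exact: fine_ge0.
by rewrite -lee_fin fineK// ge0_fin_numE// (le_lt_trans le_e)// ltry.
Qed.
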